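(* For integers $n\ge2$ the following hold. (a) If $n\ge3$ and $k\in\mathbb{N}$ is such that $2^k<n\le2^{k+1}$, then $$D_n=\begin{cases}D_{2^{k+1}-n+1}+(2n-2^{k+1}-1)(k+1)+1&\text{if }n\le3\cdot2^{k-1},\\ D_{n-2^k}+2n+2^k(k-2)&\text{if }n>3\cdot2^{k-1}.\end{cases}$$ (b) The leading coefficient of $\mathcal{H}(n,t)$ belongs to $\{1,-1\}$. (c) $\deg_t\mathcal{H}(n,t)=D_n$.
   Context: $\mathbb{N}=\{0,1,2,\ldots\}$. For a sequence $\mathbf{w}=(w_j)_{j\ge0}$ (here of indeterminates) and $m\in\mathbb{N}$ with binary expansion $m=\sum_j\varepsilon_j2^j$, $\varepsilon_j\in\{0,1\}$, put $s_{\mathbf{w}}(m)=\sum_jw_j\varepsilon_j$ and, for $n\ge1$, $\mathcal{H}_{\mathbf{w}}(n)=\det[s_{\mathbf{w}}(i+j)]_{0\le i,j<n}$, a polynomial in the $w_j$. $\mathcal{H}(n,t)$ denotes the polynomial in $t$ obtained by setting $w_j=t^j$ for all $j$. For a nonzero polynomial $P=\sum_{a\in\mathcal{A}}c_aw_0^{a_0}w_1^{a_1}\cdots w_l^{a_l}$ with $\mathcal{A}\subset\mathbb{N}^{l+1}$ finite and all $c_a\ne0$, its weighted degree is $D(P)=\max\{\sum_{j=0}^lja_j: a\in\mathcal{A}\}$. Put $D_n=D(\mathcal{H}_{\mathbf{w}}(n))$ for $n\ge2$. *)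

(* Defs.v *)
From HB Require Import structures.
From mathcomp Require Import all_boot all_order all_algebra.
From mathcomp Require Export finmap.
From mathcomp Require Export monalg.

Set Implicit Arguments.
Unset Strict Implicit.
Unset Printing Implicit Defensive.

Import GRing.Theory.
Local Open Scope ring_scope.

(* s_w(m) = sum_j w_j eps_j, where eps_j = odd (m %/ 2 ^ j) is the j-th binary
   digit of m.  The bound j < m loses nothing: m < 2 ^ m, so eps_j = 0 when
   j >= m. *)
Definition digit_sum (R : comNzRingType) (w : nat -> R) (m : nat) : R :=
  \sum_(j < m) w j *+ odd (m %/ 2 ^ j)%N.

Definition hankel_det (R : comNzRingType) (w : nat -> R) (n : nat) : R :=
  \det (\matrix_(i < n, j < n) digit_sum w (i + j)).

(* Integer polynomials in the countably many indeterminates w_0, w_1, ... *)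
Definition wpoly := {malg int[{cmonom nat}]}.

Definition wvar (j : nat) : wpoly := mkmalgU (ucm j) 1.

Definition Hw (n : nat) : wpoly := hankel_det wvar n.

(* The weighted degree is 0 by convention on the zero polynomial. *)
Definition wdeg (P : wpoly) : nat :=
  (\max_(a <- msupp P) \sum_(j <- finsupp a) j * a j)%N.

Definition D (n : nat) : nat := wdeg (Hw n).

(* The substitution w_j := t ^ j, with t = 'X. *)
Definition subst_powers (P : wpoly) : {poly int} :=
  mmap (@polyC int)
    (fun a : {cmonom nat} => \prod_(j <- finsupp a) ('X^j) ^+ (a j)) P.

Definition Ht (n : nat) : {poly int} := subst_powers (Hw n).

(* Main.v *)
From HB Require Import structures.
Require Import Defs.
From mathcomp Require Import all_boot all_order all_algebra.
From mathcomp Require Import perm.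
From mathcomp Require Import zify ring.

Set Implicit Arguments.
Unset Strict Implicit.
Unset Printing Implicit Defensive.

Import GRing.Theory.
Local Open Scope ring_scope.

(** The polynomials are determinants whose leading terms multiply when the index
    set is split according to parity.

    Write x = w_0 and let s' be the digit sum for the shifted weights
    w_1, w_2, ..., so that s(2m) = s'(m) and s(2m+1) = s'(m) + x.  Let G_p(s) be
    the p x p Hankel determinant of the second differences of s, and let
    F_p(s, z) be that of the first differences of s, each increased by the
    constant z.  Read a Hankel matrix as the Gram matrix of a bilinear form
    (X^i, X^j) -> c(i+j), and replace the monomials of odd degree by
    X^(2b) (X + e), with e = 1 or -1.  For a suitable e most of the Gram matrix
    vanishes, and up to sign

      G_(p+q)(s) = F_p(s', -2x) G_q(s')          for p = q or p = q + 1,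
      F_(2p)(s, z) = F_p(s', -2x) F_p(s', 2z),
      F_(2p+1)(s, z) = (x + z) G_p(s')^2.

    The Hankel determinant H_n of s itself is not quite a product, because its
    off-diagonal blocks are constant, equal to x: for n = p + q as above and
    q > 0, H_n(s) is H_p(s') F_q(s', -2x) plus or minus x^2 G_(p-1)(s') T_(q-1)(s'),
    where T is the Hankel determinant of third differences and also the
    coefficient of z in F.

    Now put a power t^j in front of every w_j.  A shift of the weights by one
    multiplies every term by a power of t, while x and z stay of low degree;
    hence z never reaches the leading term of F, and the correction term never
    reaches that of H_n once n > 2.  By induction all leading coefficients are
    plus or minus a monomial in the w_j, and the degrees are explicit in terms of
    the number of ones b(i) in the binary expansion of i:

      deg F_p = 2 (b(0) + ... + b(p-1)),   deg G_p = deg F_p + b(p),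
      deg H_n = deg G_(n-1) + k - 1        when 2^k < n <= 2^(k+1).

    These leading terms hold over any commutative ring.  Over the ring of the
    polynomials in the w_j the degree in t is the weighted degree, which bounds
    D_n from above; over the integers, with every w_j equal to 1, the leading
    coefficient is 1 or -1, so the bound is attained and (b) and (c) follow.
    For (a), the symmetry b(i) + b(2^k - 1 - i) = k gives
    deg G_a - deg G_b = (a - b) k whenever a + b = 2^k - 1.  Both cases of the
    recursion compare n with q = 2^(k+1) - n + 1 in this way, the second one
    passing through the comparison of n - 2^k with the same q. *)

(** * Determinants of matrices given by functions on natural numbers *)

Section Det.
Variable R : comNzRingType.
Implicit Types (A B : nat -> nat -> R) (x y z : R) (c : nat -> R).

(** Indexing by natural numbers rather than ordinals avoids casts when an index
    set is split or reordered. *)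
Definition detn n A : R := \det (\matrix_(i < n, j < n) A i j).

Definition hankel c n : R := detn n (fun i j => c (i + j)%N).

Definition eq_sign x y := exists b : bool, x = (-1) ^+ b * y.

Lemma eq_detn n A B :
  (forall i j, (i < n)%N -> (j < n)%N -> A i j = B i j) -> detn n A = detn n B.
Proof. by move=> eqAB; congr (\det _); apply/matrixP => i j; rewrite !mxE eqAB. Qed.

Lemma eq_hankel n c c' : c =1 c' -> hankel c n = hankel c' n.
Proof. by move=> eqc; apply: eq_detn => i j _ _; rewrite eqc. Qed.

Lemma detn_tr n A : detn n (fun i j => A j i) = detn n A.
Proof. by rewrite /detn -det_tr; congr (\det _); apply/matrixP => i j; rewrite !mxE. Qed.

Lemma detn0 A : detn 0 A = 1.
Proof. exact: det_mx00. Qed.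

Lemma detn1 A : detn 1 A = A 0%N 0%N.
Proof. by rewrite /detn det_mx11 mxE. Qed.

Lemma hankel0 c : hankel c 0 = 1.
Proof. exact: detn0. Qed.

Lemma detn_lblock p q A :
    (forall i j, (i < p)%N -> (j < q)%N -> A i (p + j)%N = 0) ->
  detn (p + q) A = detn p A * detn q (fun i j => A (p + i)%N (p + j)%N).
Proof.
move=> A0; rewrite /detn; set M := (X in \det X).
rewrite -[M]submxK [ursubmx M](_ : _ = 0) ?det_lblock.
  by congr GRing.mul; congr (\det _); apply/matrixP => i j; rewrite !mxE.
by apply/matrixP => i j; rewrite !mxE /= A0.
Qed.

Lemma detn_ublock p q A :
    (forall i j, (i < q)%N -> (j < p)%N -> A (p + i)%N j = 0) ->
  detn (p + q) A = detn p A * detn q (fun i j => A (p + i)%N (p + j)%N).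
Proof.
move=> A0; rewrite -detn_tr detn_lblock => [|i j ltip ltjq]; last exact: A0.
by congr (_ * _); rewrite -detn_tr.
Qed.

(** The new rows are obtained by multiplying by a unitriangular matrix, since
    each row only receives a multiple of an earlier one. *)
Lemma detn_shear_row n A (e : nat -> R) (g : nat -> nat) :
    (forall i, (g i < i)%N \/ e i = 0) ->
  detn n (fun i j => A i j + e i * A (g i) j) = detn n A.
Proof.
move=> lt_g; pose N : 'M[R]_n := \matrix_(i, j) (e i *+ (g i == j :> nat)).
rewrite /detn; set M := (X in _ = \det X); set M' := (X in \det X = _).
have ->: M' = (1%:M + N) *m M.
  apply/matrixP => i j; rewrite mulmxDl mul1mx !mxE; congr (_ + _).
  have [lt_gi | e0] := lt_g i; last first.
    by rewrite e0 mul0r big1 // => l _; rewrite !mxE e0 mul0rn mul0r.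
  pose l := Ordinal (ltn_trans lt_gi (ltn_ord i)).
  rewrite (bigD1 l) //= big1 ?addr0 => [|l' ne_l]; rewrite !mxE /= ?eqxx ?mulr1n //.
  by rewrite eq_sym; move: ne_l; rewrite -val_eqE /= => /negPf ->; rewrite mul0r.
rewrite det_mulmx det_trig ?big1 ?mul1r // => [i _|].
  rewrite !mxE eqxx; case: (lt_g i) => [lt_gi | ->]; last by rewrite mul0rn addr0.
  by rewrite (ltn_eqF lt_gi) addr0.
apply/is_trig_mxP => i j lt_ij; rewrite !mxE -val_eqE /= (ltn_eqF lt_ij) add0r.
case: (lt_g i) => [lt_gi | ->]; last by rewrite mul0rn.
by rewrite (ltn_eqF (ltn_trans lt_gi lt_ij)).
Qed.

Lemma detn_shear_col n A (e : nat -> R) (g : nat -> nat) :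
    (forall i, (g i < i)%N \/ e i = 0) ->
  detn n (fun i j => A i j + e j * A i (g j)) = detn n A.
Proof.
move=> lt_g; rewrite -detn_tr -[RHS]detn_tr.
exact: (detn_shear_row n (fun i j => A j i)).
Qed.

Lemma detn_reindex_row n A (f : nat -> nat) :
    (forall i, (i < n)%N -> (f i < n)%N) ->
    (forall i j, (i < n)%N -> (j < n)%N -> f i = f j -> i = j) ->
  eq_sign (detn n (fun i j => A (f i) j)) (detn n A).
Proof.
move=> lt_f inj_f; pose F (i : 'I_n) := Ordinal (lt_f i (ltn_ord i)).
have injF : injective F by move=> i j [/inj_f eq_ij]; apply/val_inj/eq_ij.
exists (odd_perm (perm injF)).
rewrite /detn -det_perm -det_mulmx -row_permE; congr (\det _).
by apply/matrixP => i j; rewrite !mxE permE.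
Qed.

Lemma eq_sign_eq x y : x = y -> eq_sign x y.
Proof. by move=> ->; exists false; rewrite mul1r. Qed.

Lemma eq_sign_trans y x z : eq_sign x y -> eq_sign y z -> eq_sign x z.
Proof.
by move=> [b ->] [b' ->]; exists (b (+) b'); rewrite signr_addb mulrA.
Qed.

Lemma detn_reindex n A (f g : nat -> nat) :
    (forall i, (i < n)%N -> (f i < n)%N /\ (g i < n)%N) ->
    (forall i j, (i < n)%N -> (j < n)%N -> f i = f j -> i = j) ->
    (forall i j, (i < n)%N -> (j < n)%N -> g i = g j -> i = j) ->
  eq_sign (detn n (fun i j => A (f i) (g j))) (detn n A).
Proof.
move=> lt_fg inj_f inj_g; apply: (@eq_sign_trans (detn n (fun i j => A i (g j)))).
  by apply: (detn_reindex_row (fun i j => A i (g j))) => // i /lt_fg[].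
rewrite -detn_tr -[X in eq_sign _ X]detn_tr.
by apply: (detn_reindex_row (fun i j => A j i)) => // i /lt_fg[].
Qed.

(** Linearity of the determinant in row [r]: the perturbation of that row is a
    multiple of a basis vector. *)
Lemma detn_add_entry n A r l x : (r < n)%N -> (l < n)%N ->
  detn n (fun i j => A i j + x *+ ((i == r) && (j == l)))
  = detn n A + x * detn n (fun i j => if i == r then (j == l)%:R else A i j).
Proof.
move=> lt_rn lt_ln; pose r' := Ordinal lt_rn.
rewrite -[detn n A]mul1r; apply: (@determinant_multilinear _ _ _ _ _ r').
- by apply/rowP => j; rewrite !mxE eqxx /= !mul1r mulr_natr.
- apply/matrixP => i j; rewrite !mxE.
  by have /negPf := neq_lift r' i; rewrite eq_sym -val_eqE /= => ->; rewrite addr0.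
- apply/matrixP => i j; rewrite !mxE.
  by have /negPf := neq_lift r' i; rewrite eq_sym -val_eqE /= => ->; rewrite addr0.
Qed.

(** * Parity blocks and constant off-diagonal blocks *)

Definition blocks p (A B C D : nat -> nat -> R) i j : R :=
  if (i < p)%N then (if (j < p)%N then A i j else B i (j - p)%N)
  else (if (j < p)%N then C (i - p)%N j else D (i - p)%N (j - p)%N).

Lemma detn_blocks_lower p q A B C D :
    (forall i j, (i < p)%N -> (j < q)%N -> B i j = 0) ->
  detn (p + q) (blocks p A B C D) = detn p A * detn q D.
Proof.
move=> B0; rewrite detn_lblock => [|i j ltip ltjq]; last first.
  by rewrite /blocks ltip ltnNge leq_addr addKn B0.
congr (_ * _); apply: eq_detn => i j lti ltj; rewrite /blocks.
  by rewrite lti ltj.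
by rewrite !ltnNge !leq_addr !addKn.
Qed.

Lemma detn_blocks_antidiag p A B C D :
    (forall i j, (i < p)%N -> (j < p)%N -> D i j = 0) ->
  eq_sign (detn (p + p) (blocks p A B C D)) (detn p B * detn p C).
Proof.
move=> D0; pose f i := if (i < p)%N then (p + i)%N else (i - p)%N.
have := @detn_reindex_row (p + p) (blocks p A B C D) f.
case=> [i lt_i|i j lt_i lt_j|b eq_det]; rewrite /f.
- by case: ifP; lia.
- by do 2 case: ifP; lia.
exists b; apply: (canRL (signrMK b)).
rewrite -eq_det mulrC -(@detn_blocks_lower p p C D A B) //.
apply: eq_detn => i j lt_i lt_j; rewrite /f /blocks.
case: (ltnP i p) => ip; first by rewrite !ltnNge !leq_addr addKn.
by have -> : (i - p < p)%N by lia.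
Qed.

(** In terms of Gram matrices, the rows are expressed in the basis X^(2a),
    X^(2b) (X + e) and the columns in X^(2a), X^(2b) (X + e'), even degrees
    first. *)
Lemma hankel_parity p q c e e' : (q <= p <= q.+1)%N ->
  eq_sign (hankel c (p + q)) (detn (p + q) (blocks p
    (fun i j => c (i + j).*2)
    (fun i j => c (i + j).*2.+1 + e' * c (i + j).*2)
    (fun i j => c (i + j).*2.+1 + e * c (i + j).*2)
    (fun i j => c (i + j).*2.+2 + (e + e') * c (i + j).*2.+1
                + e * e' * c (i + j).*2))).
Proof.
move=> le_pq.
(* [f] lists the even indices below p + q, then the odd ones. *)
pose f i := if (i < p)%N then i.*2 else (i - p).*2.+1.
pose o (a : R) i := if odd i then a else 0.
have o_ok a i : (i.-1 < i)%N \/ o a i = 0.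
  by case: i => [|i]; [right | left].
rewrite /hankel -(detn_shear_row _ _ (o_ok e)) -(detn_shear_col _ _ (o_ok e')).
set A := (X in detn _ X).
have [|||b eq_det] := @detn_reindex (p + q) A f f.
- by move=> i lt_i; rewrite /f; case: ifP; lia.
- by move=> i j lt_i lt_j; rewrite /f; do 2 case: ifP; lia.
- by move=> i j lt_i lt_j; rewrite /f; do 2 case: ifP; lia.
exists b; apply: (canRL (signrMK b)); rewrite -eq_det.
apply: eq_detn => i j lt_i lt_j; rewrite /A /f /blocks /o.
case: (ltnP i p) => ip; case: (ltnP j p) => jp;
  rewrite /= ?odd_double /= ?mul0r ?addr0 ?addSn ?addnS -?doubleD //.
ring.
Qed.

(** The two diagonal blocks only interact through their first basis vectors.
    Splitting off the single nonzero entry of the lower left block leaves a block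
    triangular matrix; in the remaining term that entry is the only one in its
    row, and exchanging the first rows of the two blocks makes everything
    triangular again. *)
Lemma detn_coupled p q A x y :
    (forall i j, (i <= p)%N -> (j <= q)%N ->
       A i (p.+1 + j)%N = x *+ ((i == 0%N) && (j == 0%N)) /\
       A (p.+1 + j)%N i = y *+ ((i == 0%N) && (j == 0%N))) ->
  exists b : bool, detn (p.+1 + q.+1) A =
    detn p.+1 A * detn q.+1 (fun i j => A (p.+1 + i)%N (p.+1 + j)%N)
    + (-1) ^+ b * (x * y * (detn p (fun i j => A i.+1 j.+1)
        * detn q (fun i j => A (p.+1 + i.+1)%N (p.+1 + j.+1)%N))).
Proof.
move=> Aoff; set n := (p.+1 + q.+1)%N.
pose A1 i j := if (i == p.+1) && (j == 0%N) then 0 else A i j.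
pose A2 i j := if i == p.+1 then (j == 0%N)%:R else A1 i j.
have A10 i j : (i <= p)%N -> (j <= q)%N -> A1 (p.+1 + j)%N i = 0.
  move=> le_i le_j; rewrite /A1; have [_ ->] := Aoff i j le_i le_j.
  have -> : (p.+1 + j == p.+1)%N = (j == 0%N) by lia.
  by do 2 case: eqP.
have -> : detn n A = detn n A1 + y * detn n A2.
  rewrite -detn_add_entry; try lia.
  apply: eq_detn => i j lt_i lt_j; rewrite /A1.
  case: andP => [[/eqP -> /eqP ->]|_]; last by rewrite addr0.
  by rewrite add0r -[p.+1]addn0; have [_ ->] := Aoff 0%N 0%N isT isT.
have -> : detn n A1 = detn p.+1 A * detn q.+1 (fun i j => A (p.+1 + i)%N (p.+1 + j)%N).
  rewrite /n detn_ublock => [|i j lt_i lt_j]; last by rewrite A10.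
  congr (_ * _); apply: eq_detn => i j lt_i lt_j; rewrite /A1.
    by rewrite (_ : i == p.+1 = false) //; lia.
  by rewrite andbF.
pose f i := if i == 0%N then p.+1 else if i == p.+1 then 0%N else i.
have [||b eq_det] := @detn_reindex_row n A2 f.
- by move=> i; rewrite /f /n; do ?case: ifP; lia.
- by move=> i j; rewrite /f /n; do ?case: ifP; lia.
have f0 : f 0%N = p.+1 by [].
have fS i : (i < p)%N -> f i.+1 = i.+1 by rewrite /f /=; case: eqP; lia.
have fp : f p.+1 = 0%N by rewrite /f /= eqxx.
have fq i : f (p.+1 + i.+1)%N = (p.+1 + i.+1)%N by rewrite /f /=; case: eqP; lia.
exists b; congr (_ + _).
rewrite [x * y]mulrC -mulrA mulrCA; congr (_ * _).
apply: (canRL (signrMK b)); rewrite -eq_det.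
rewrite /n addSn -add1n detn_lblock; last first.
  by case=> // j _ lt_j; rewrite f0 /A2 eqxx.
rewrite detn1 f0 {1}/A2 !eqxx mul1r detn_lblock; last first.
  move=> i j lt_i lt_j; rewrite add1n fS // /A2 /A1.
  rewrite (_ : i.+1 == p.+1 = false) /=; last lia.
  by rewrite addSn; have [-> _] := Aoff i.+1 j lt_i lt_j.
rewrite -(add1n q) detn_lblock; last first.
  case=> // j _ lt_j; rewrite add1n addn0 fp /A2 /A1 /=.
  by rewrite add1n -addSn; have [-> _] := Aoff 0%N j.+1 isT lt_j.
rewrite detn1 addn0 add1n fp {2}/A2 /A1 /=.
have [] := Aoff 0%N 0%N isT isT; rewrite addn0 => -> _.
rewrite mulr1n mulrCA; congr (_ * (_ * _)); apply: eq_detn => i j lt_i lt_j.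
  rewrite add1n fS // /A2 /A1 andbF (_ : i.+1 == p.+1 = false) //; lia.
rewrite !add1n -!addSn fq /A2 /A1 (_ : (p.+1 + i.+1 == p.+1)%N = false) //.
by rewrite -{2}(addn0 p.+1) eqn_add2l.
Qed.

(** The Gram matrix of the differences of consecutive basis vectors. *)
Definition mixed_diff A i j : R := A i.+1 j.+1 - A i j.+1 - A i.+1 j + A i j.

Lemma detn_diff n A :
  detn n A = detn n (fun i j => A i j - (if i is i'.+1 then A i' j else 0)
     - (if j is j'.+1 then
          A i j' - (if i is i'.+1 then A i' j' else 0) else 0)).
Proof.
pose e i : R := if i is _.+1 then -1 else 0.
have e_ok i : (i.-1 < i)%N \/ e i = 0 by case: i => [|i]; [right | left].
rewrite -(detn_shear_row n A e_ok) -(detn_shear_col _ _ e_ok).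
by apply: eq_detn => -[|i] [|j] _ _; rewrite /e /=; ring.
Qed.

(** In the basis of differences used by [detn_diff] the all-ones matrix has a single nonzero entry, in
    the corner, whose minor is the determinant of mixed differences. *)
Lemma detn_add_const n A x :
  detn n.+1 (fun i j => A i j + x) = detn n.+1 A + x * detn n (mixed_diff A).
Proof.
rewrite detn_diff [detn n.+1 A]detn_diff.
set B := (X in _ = detn _ X + _).
have := @detn_add_entry n.+1 B 0 0 x isT isT.
set C := (X in _ + _ * detn _ X) => eqC.
have -> : detn n (mixed_diff A) = detn n.+1 C.
  rewrite -add1n detn_lblock => [|[]//].
  rewrite detn1 mul1r; apply: eq_detn => i j _ _; rewrite /C /B /mixed_diff /=; ring.
rewrite -eqC; apply: eq_detn => -[|i] [|j] _ _; rewrite /B /=; ring.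
Qed.

(** Taking differences inside each block turns constant off-diagonal blocks into
    blocks with a single nonzero entry, which is the case of [detn_coupled]. *)
Lemma detn_coupled_const p q A x :
    (forall i j, (i <= p)%N -> (j <= q)%N ->
       A i (p.+1 + j)%N = x /\ A (p.+1 + j)%N i = x) ->
  exists b : bool, detn (p.+1 + q.+1) A =
    detn p.+1 A * detn q.+1 (fun i j => A (p.+1 + i)%N (p.+1 + j)%N)
    + (-1) ^+ b * (x ^+ 2 * (detn p (mixed_diff A)
        * detn q (mixed_diff (fun i j => A (p.+1 + i)%N (p.+1 + j)%N)))).
Proof.
move=> Ax.
(* Coefficient 0 protects the first vector of each block. *)
pose e i : R := if (i == 0%N) || (i == p.+1) then 0 else -1.
have e_ok i : (i.-1 < i)%N \/ e i = 0 by case: i => [|i]; [right | left].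
have eS i : (i < p)%N -> e i.+1 = -1.
  by move=> lt_i; rewrite /e (_ : i.+1 == p.+1 = false) //; lia.
have e0 : e 0%N = 0 by [].
have ep : e p.+1 = 0 by rewrite /e eqxx orbT.
have epS i : e (p.+1 + i.+1)%N = -1.
  by rewrite /e (_ : (p.+1 + i.+1 == p.+1)%N = false) //; lia.
rewrite -(detn_shear_row _ A e_ok) -(detn_shear_col _ _ e_ok).
have [|b ->] := @detn_coupled p q (fun i j => A i j + e i * A i.-1 j +
    e j * (A i j.-1 + e i * A i.-1 j.-1)) x x.
  move=> i j le_i le_j.
  have A0 i' (le_i' : (i' <= p)%N) : A i' p.+1 = x /\ A p.+1 i' = x.
    by have := Ax i' 0%N le_i' isT; rewrite addn0.
  have AS i' j' (le_i' : (i' <= p)%N) (lt_j' : (j' < q)%N) :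
    A i' (p.+2 + j')%N = x /\ A (p.+2 + j')%N i' = x.
    by have := Ax i' j'.+1 le_i' lt_j'; rewrite addnS -addSn.
  case: i le_i => [|i] le_i; case: j le_j => [|j] le_j;
    rewrite ?addn0 ?ep ?epS ?eS //= ?addnS /= -?addSn ?e0.
  - by have [-> ->] := A0 0%N le_i; split; ring.
  - have [-> ->] := Ax 0%N j le_i (ltnW le_j).
    by have [-> ->] := AS 0%N j le_i le_j; split; ring.
  - have [-> ->] := A0 i (ltnW le_i).
    by have [-> ->] := A0 i.+1 le_i; split; ring.
  have [-> ->] := AS i j (ltnW le_i) le_j; have [-> ->] := AS i.+1 j le_i le_j.
  have [-> ->] := Ax i j (ltnW le_i) (ltnW le_j).
  by have [-> ->] := Ax i.+1 j le_i (ltnW le_j); split; ring.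
pose e' i : R := if i is _.+1 then -1 else 0.
have e'_ok i : (i.-1 < i)%N \/ e' i = 0 by case: i => [|i]; [right | left].
have ee' i : (i <= p)%N -> e i = e' i by case: i => [_|i /eS] //; rewrite e0.
have e'p i : e (p.+1 + i)%N = e' i by case: i => [|i]; rewrite ?addn0 ?ep ?epS.
exists b; congr (_ * _ + _ * (_ * (_ * _))).
- rewrite -[RHS](detn_shear_row _ _ e'_ok) -[RHS](detn_shear_col _ _ e'_ok).
  by apply: eq_detn => i j lt_i lt_j; rewrite !ee'.
- rewrite -[RHS](detn_shear_row _ _ e'_ok) -[RHS](detn_shear_col _ _ e'_ok).
  apply: eq_detn => i j _ _; rewrite !e'p.
  by case: i => [|i]; case: j => [|j] /=; rewrite ?mul0r ?addr0 // ?addnS.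
- by apply: eq_detn => i j lt_i lt_j; rewrite !eS //= /mixed_diff; ring.
by apply: eq_detn => i j lt_i lt_j; rewrite !epS /mixed_diff !addnS /=; ring.
Qed.

End Det.

(** * Parity factorisations of Hankel determinants of differences *)

Section Parity.
Variable R : comNzRingType.
Implicit Types (s : nat -> R) (x z : R) (p q : nat).

Definition d1 s m := s m.+1 - s m.
Definition d2 s m := d1 s m.+1 - d1 s m.
Definition d3 s m := d2 s m.+1 - d2 s m.

Definition hankel_d1 s z p := hankel (fun m => d1 s m + z) p.
Definition hankel_d2 s p := hankel (d2 s) p.
Definition hankel_d3 s p := hankel (d3 s) p.

Definition parity_split s s' x :=
  forall m, s m.*2 = s' m /\ s m.*2.+1 = s' m + x.

Lemma mixed_diff_hankel c i j :
  mixed_diff (fun i j => c (i + j)%N) i j = d2 c (i + j)%N :> R.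
Proof. by rewrite /mixed_diff /d2 /d1 !addSn !addnS; ring. Qed.

Lemma hankel_d1_affine s z p :
  hankel_d1 s z p.+1 = hankel_d1 s 0 p.+1 + z * hankel_d3 s p.
Proof.
rewrite /hankel_d1 /hankel detn_add_const.
congr (_ + _ * _); apply: eq_detn => i j _ _; first by rewrite addr0.
by rewrite (mixed_diff_hankel (d1 s)).
Qed.

Variables (s s' : nat -> R) (x : R).
Hypothesis s_split : parity_split s s' x.

Let s0 m : s m.*2 = s' m. Proof. by have [] := s_split m. Qed.
Let s1 m : s m.*2.+1 = s' m + x. Proof. by have [] := s_split m. Qed.
Let s2 m : s m.*2.+2 = s' m.+1. Proof. by rewrite -doubleS s0. Qed.
Let s3 m : s m.*2.+3 = s' m.+1 + x. Proof. by rewrite -doubleS s1. Qed.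
Let s4 m : s m.*2.+4 = s' m.+2. Proof. by rewrite -doubleS s2. Qed.
Let s5 m : s m.*2.+1.+4 = s' m.+2 + x. Proof. by rewrite -!doubleS s1. Qed.

Let sE := (s0, s1, s2, s3, s4, s5).

(** With e = e' = 1 the two parity classes are orthogonal.  Indeed second
    differences of s come from the factor (X - 1)^2, and
    (X - 1)^2 (X + 1) = (X - 1) (X^2 - 1) makes a mixed product the difference of
    two values s (2 m + 1) - s (2 m), all equal to x.  In the odd-odd block the
    factor is (X^2 - 1)^2, a second difference of s'. *)
Lemma hankel_d2_parity p q : (q <= p <= q.+1)%N ->
  eq_sign (hankel_d2 s (p + q)) (hankel_d1 s' (- 2 * x) p * hankel_d2 s' q).
Proof.
move=> le_pq; apply: eq_sign_trans (hankel_parity (d2 s) 1 1 le_pq) _.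
rewrite detn_blocks_lower => [|i j _ _]; last by rewrite /d2 /d1 !sE; ring.
apply: eq_sign_eq; congr (_ * _); apply: eq_detn => i j _ _.
  by rewrite /d2 /d1 !sE; ring.
by rewrite /d2 /d1 !sE; ring.
Qed.

(** Rows use X - 1 and columns X + 1.  The product X^2 - 1 makes the odd-odd
    entries differences of two values s (2 m + 1) - s (2 m) + z, all equal to
    x + z, so the matrix is block antitriangular. *)
Lemma hankel_d1_even p z :
  eq_sign (hankel_d1 s z (p + p))
          (hankel_d1 s' (- 2 * x) p * hankel_d1 s' (2 * z) p).
Proof.
have le_pp : (p <= p <= p.+1)%N by lia.
apply: eq_sign_trans (hankel_parity _ (-1) 1 le_pp) _.
apply: eq_sign_trans (detn_blocks_antidiag _ _ _ _) _.
  by move=> i j _ _; rewrite /d1 !sE; ring.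
rewrite mulrC; apply: eq_sign_eq; congr (_ * _); apply: eq_detn => i j _ _.
  by rewrite /d1 !sE; ring.
by rewrite /d1 !sE; ring.
Qed.

(** With e = e' = -1, the mixed products s (2 m + 1) - s (2 m) are all equal
    to x. *)
Lemma hankel_parity2 p q : (q <= p <= q.+1)%N ->
  exists b : bool, eq_sign (hankel s (p.+1 + q.+1))
    (hankel s' p.+1 * hankel_d1 s' (- 2 * x) q.+1
     + (-1) ^+ b * (x ^+ 2 * (hankel_d2 s' p * hankel_d3 s' q))).
Proof.
move=> le_pq; have le_pq1 : (q.+1 <= p.+1 <= q.+2)%N by lia.
have := hankel_parity s (-1) (-1) le_pq1; set A := (X in detn _ X) => eq_h.
have [|b eqA] := @detn_coupled_const _ p q A x.
  move=> i j le_i le_j; rewrite /A /blocks !ltnS le_i ltnNge leq_addr /=.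
  by rewrite addKn !sE addnC; split; ring.
exists b; apply: eq_sign_trans eq_h _; rewrite {}eqA.
apply: eq_sign_eq.
have Aq i j : A (p.+1 + i)%N (p.+1 + j)%N = d1 s' (i + j)%N - 2 * x.
  by rewrite /A /blocks !ltnNge !leq_addr /= !addKn !sE /d1; ring.
congr (_ * _ + _ * (_ * (_ * _))); apply: eq_detn => i j lt_i lt_j.
- by rewrite /A /blocks lt_i lt_j s0.
- by rewrite Aq mulNr.
- rewrite /mixed_diff /A /blocks !ltnS lt_i lt_j !(ltnW lt_i, ltnW lt_j) /=.
  by rewrite !s0 -mixed_diff_hankel.
by rewrite /mixed_diff !Aq !addSn !addnS /d3 /d2; ring.
Qed.

(** The even-even block is constant, so replacing X^(2a+2) by X^(2a+2) - X^(2a)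
    empties it except for the corner x + z.  Call v the p even differences, u the
    vector 1 and y the p vectors X^(2b+1) - X^(2b).  Rows listed as v, u, y and
    columns as y, u, v give a block triangular matrix; v and y pair through second
    differences of s', once in each of the outer diagonal blocks. *)
Lemma hankel_d1_odd p z :
  eq_sign (hankel_d1 s z (p + p).+1) ((x + z) * hankel_d2 s' p ^+ 2).
Proof.
pose e i : R := if i == 0%N then 0 else -1.
pose g i := if odd i then i.-1 else i.-2.
have e_ok i : (g i < i)%N \/ e i = 0.
  by case: i => [|i]; [by right | left]; rewrite /g; case: ifP => _ /=; lia.
pose n := (p + (1 + p))%N; have -> : (p + p).+1 = n by rewrite /n; lia.
pose fr i := if (i < p)%N then i.*2.+2 else
             if i == p then 0%N else (i - p.+1).*2.+1.
pose fc i := if (i < p)%N then i.*2.+1 else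
             if i == p then 0%N else (i - p.+1).*2.+2.
rewrite /hankel_d1 /hankel -(detn_shear_row _ _ e_ok) -(detn_shear_col _ _ e_ok).
set A := (X in detn _ X).
have [|||b eq_det] := @detn_reindex _ n A fr fc.
- by move=> i; rewrite /fr /fc /n; do ?case: ifP; lia.
- by move=> i j; rewrite /fr /n; do ?case: ifP; lia.
- by move=> i j; rewrite /fc /n; do ?case: ifP; lia.
exists b; apply: (canRL (signrMK b)); rewrite -eq_det.
have fr0 i : (i < p)%N -> fr i = i.*2.+2 by rewrite /fr => ->.
have fc0 i : (i < p)%N -> fc i = i.*2.+1 by rewrite /fc => ->.
have fr1 : fr p = 0%N by rewrite /fr ltnn eqxx.
have fc1 : fc p = 0%N by rewrite /fc ltnn eqxx.
have fr2 i : fr (p + (1 + i))%N = i.*2.+1 by rewrite /fr; do ?case: ifP; lia.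
have fc2 i : fc (p + (1 + i))%N = i.*2.+2 by rewrite /fc; do ?case: ifP; lia.
rewrite detn_lblock => [|i [|j] lt_i lt_j].
- rewrite detn_lblock => [|[|//] j _ _].
    rewrite detn1 !addn0 fr1 fc1 {2}/A /e /= /d1.
    rewrite (s0 0) (s1 0) mulrCA; congr (_ * _); first by ring.
    rewrite expr2; congr (_ * _); apply: eq_detn => i j lt_i lt_j.
      rewrite fr0 // fc0 // /A /e /g /= ?odd_double /=.
      by rewrite ?addSn ?addnS -?doubleD /d2 /d1 !sE; ring.
    rewrite fr2 // fc2 // /A /e /g /= ?odd_double /=.
    by rewrite ?addSn ?addnS -?doubleD /d2 /d1 !sE; ring.
  rewrite fc2 addn0 fr1 /A /e /g /= ?odd_double /=.
  by rewrite /d1 !sE; ring.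
- rewrite addn0 fc1 fr0 // /A /e /g /= ?odd_double /=.
  by rewrite ?addn0 /d1 !sE; ring.
rewrite fr0 // fc2 /A /e /g /= ?odd_double /=.
by rewrite ?addSn ?addnS -?doubleD /d1 !sE; ring.
Qed.

End Parity.

(** * Binary digits and the degrees *)

Section BinaryDigits.
Variable V : nmodType.
Implicit Types (w : nat -> V) (m n : nat).

(** The sum of [digit_sum], stated for additive monoids so that it also counts
    digits in the natural numbers. *)
Definition digit_total w m : V := \sum_(j < m) w j *+ odd (m %/ 2 ^ j).

Lemma digit_total_widen w m n : (m <= n)%N ->
  digit_total w m = \sum_(j < n) w j *+ odd (m %/ 2 ^ j).
Proof.
move=> le_mn; rewrite /digit_total.
rewrite -!(big_mkord xpredT (fun j => w j *+ odd (m %/ 2 ^ j))).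
rewrite [RHS](big_cat_nat _ le_mn) //= -[LHS]addr0; congr (_ + _).
rewrite big_nat_cond big1 //.
move=> j /andP[/andP[le_mj _] _]; rewrite divn_small ?mulr0n //.
by apply: leq_ltn_trans le_mj _; apply: ltn_expl.
Qed.

Lemma digit_total_half w n :
  digit_total w n = w 0%N *+ odd n + digit_total (fun j => w j.+1) n./2.
Proof.
rewrite (digit_total_widen w (leqnSn n)) big_ord_recl expn0 divn1; congr (_ + _).
rewrite (@digit_total_widen _ n./2 n); last lia.
by apply: eq_bigr => j _; rewrite /bump /= expnS divnMA divn2.
Qed.

End BinaryDigits.

Lemma digit_sum_split (R : comNzRingType) (w : nat -> R) :
  parity_split (digit_sum w) (digit_sum (fun j => w j.+1)) (w 0%N).
Proof.
move=> m; have dE := digit_total_half w.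
split; rewrite [LHS]dE /= ?odd_double ?doubleK ?uphalf_double.
  by rewrite mulr0n add0r.
by rewrite mulr1n addrC.
Qed.

Definition popcount n : nat := digit_total (fun=> 1%N) n.

Lemma popcount_double m : popcount m.*2 = popcount m.
Proof. by rewrite /popcount digit_total_half odd_double doubleK. Qed.

Lemma popcount_doubleS m : popcount m.*2.+1 = (popcount m).+1.
Proof. by rewrite /popcount digit_total_half /= odd_double uphalf_double. Qed.

(** The degrees in t of [hankel_d1] and [hankel_d2] at size [p], when the weight
    w_j carries t^j and z is negligible. *)
Definition deg_d1 p : nat := \sum_(i < p) (popcount i).*2.
Definition deg_d2 p : nat := (deg_d1 p + popcount p)%N.

Lemma deg_d1S p : deg_d1 p.+1 = (deg_d1 p + (popcount p).*2)%N.
Proof. exact: big_ord_recr. Qed.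

Lemma deg_d1_double p : deg_d1 p.*2 = ((deg_d1 p).*2 + p.*2)%N.
Proof.
elim: p => [|p IHp]; first by rewrite /deg_d1 !big_ord0.
by rewrite doubleS !deg_d1S IHp popcount_double popcount_doubleS; lia.
Qed.

Lemma deg_d1_doubleS p : deg_d1 p.*2.+1 = ((deg_d2 p).*2 + p.*2)%N.
Proof. by rewrite deg_d1S deg_d1_double popcount_double /deg_d2; lia. Qed.

Lemma deg_d2_parity p q : (q <= p <= q.+1)%N ->
  deg_d2 (p + q) = (deg_d1 p + deg_d2 q + (p + q))%N.
Proof.
move=> le_pq; have [->|->] : (p = q \/ p = q.+1)%N by lia.
  by rewrite addnn /deg_d2 deg_d1_double popcount_double; lia.
rewrite addSn addnn /deg_d2 deg_d1_doubleS popcount_doubleS deg_d1S /deg_d2; lia.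
Qed.

Lemma popcount0 : popcount 0 = 0%N. Proof. exact: big_ord0. Qed.

Lemma deg_d10 : deg_d1 0 = 0%N. Proof. exact: big_ord0. Qed.

Lemma deg_d2_double p : deg_d2 p.*2 = (deg_d1 p + deg_d2 p + p.*2)%N.
Proof. by rewrite -addnn deg_d2_parity //; lia. Qed.

Lemma deg_d2_doubleS p : deg_d2 p.*2.+1 = (deg_d1 p.+1 + deg_d2 p + p.*2.+1)%N.
Proof. by rewrite -addnn -addSn deg_d2_parity //; lia. Qed.

(** Behind both identities is the complementation of binary digits, which sends i
    to 2^k - 1 - i and exchanges zeros and ones; the induction on [k] follows the
    parity recursions instead, the two statements feeding each other. *)
Lemma deg_reflection k a b :
  ((a + b = 2 ^ k -> deg_d1 a + b * k = deg_d1 b + a * k) /\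
   (a + b.+1 = 2 ^ k -> deg_d2 a + b * k = deg_d2 b + a * k))%N.
Proof.
elim: k a b => [|k IHk] a b.
  split=> eq_ab; last by have [-> ->] : (a = 0 /\ b = 0)%N by lia.
  have : (a = 0 /\ b = 1 \/ a = 1 /\ b = 0)%N by lia.
  by case=> -[-> ->]; rewrite ?deg_d1S popcount0 deg_d10.
rewrite expnS mul2n -(odd_double_half a) -(odd_double_half b).
case: (odd a) (odd b) => [] []; move: a./2 b./2 => {}a {}b;
  rewrite ?add0n ?add1n; split=> eq_ab; try lia.
- have [_ /(_ ltac:(lia)) IH] := IHk a b.
  rewrite !deg_d1_doubleS; lia.
- have [_ /(_ ltac:(lia)) IH2] := IHk a b.
  have [/(_ ltac:(lia)) IH1 _] := IHk a.+1 b.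
  rewrite deg_d2_double deg_d2_doubleS; lia.
- have [_ /(_ ltac:(lia)) IH2] := IHk a b.
  have [/(_ ltac:(lia)) IH1 _] := IHk a b.+1.
  rewrite deg_d2_double deg_d2_doubleS; lia.
have [/(_ ltac:(lia)) IH _] := IHk a b.
rewrite !deg_d1_double; lia.
Qed.

(** * Leading terms *)

Section LeadingTerm.
Variables (A : comNzRingType) (w : nat -> A).
Implicit Types (P Q : {poly A}) (d l p : nat).

Definition signed_monomial (c : A) :=
  exists (b : bool) (r : seq nat), c = (-1) ^+ b * \prod_(j <- r) w j.

(** The bound on the size and a coefficient at [d], possibly zero in a general
    ring, are exactly what survives multiplication without zero divisor
    hypotheses. *)
Definition has_top d P := (size P <= d.+1)%N /\ signed_monomial P`_d.

Lemma has_top1 : has_top 0 1.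
Proof.
split; first exact: size_polyC_leq1.
by exists false, [::]; rewrite coef1 big_nil mulr1.
Qed.

Lemma coef_mul_top d d' P Q : (size P <= d.+1)%N -> (size Q <= d'.+1)%N ->
  (P * Q)`_(d + d') = P`_d * Q`_d'.
Proof.
move=> le_P le_Q; rewrite coefM (bigD1 (Ordinal (leq_addr d' d.+1))) //=.
rewrite addKn big1 ?addr0 // => i; rewrite -val_eqE /= => ne_id.
have [lt_di|lt_id] : (d < i \/ d' < d + d' - i)%N by have := ltn_ord i; lia.
  by rewrite nth_default ?mul0r //; apply: leq_trans le_P _.
by rewrite [Q`__]nth_default ?mulr0 //; apply: leq_trans le_Q _.
Qed.

Lemma size_mul_bound d d' P Q : (size P <= d.+1)%N -> (size Q <= d'.+1)%N ->
  (size (P * Q)%R <= (d + d').+1)%N.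
Proof.
move=> le_P le_Q; apply: leq_trans (size_polyMleq _ _) _.
by have := leq_add le_P le_Q; rewrite addSn addnS; case: (_ + _)%N.
Qed.

Lemma has_topM d d' P Q :
  has_top d P -> has_top d' Q -> has_top (d + d') (P * Q).
Proof.
move=> [le_P [b [r eqP]]] [le_Q [b' [r' eqQ]]]; split.
  exact: size_mul_bound.
exists (b (+) b'), (r ++ r').
by rewrite coef_mul_top // eqP eqQ signr_addb big_cat /= mulrACA.
Qed.

Lemma has_top_sign d P Q : eq_sign P Q -> has_top d Q -> has_top d P.
Proof.
move=> [b ->] [le_Q [b' [r eqQ]]]; split; first by rewrite size_Msign.
exists (b (+) b'), r.
by rewrite signr_addb -mulrA -eqQ; case: b; rewrite ?mulN1r ?mul1r ?coefN.
Qed.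

Lemma size_eq_sign P Q : eq_sign P Q -> size P = size Q.
Proof. by move=> [b ->]; rewrite size_Msign. Qed.

Lemma has_topD d P Q : has_top d P -> (size Q <= d)%N -> has_top d (P + Q).
Proof.
move=> [le_P topP] le_Q; split.
  by apply: leq_trans (size_polyD _ _) _; rewrite geq_max le_P leqW.
by rewrite coefD [Q`__]nth_default ?addr0.
Qed.

(** The sequence of weights t^j w_j shifted [l] times, as produced by [l] parity
    steps. *)
Definition graded l j : {poly A} := (w (j + l))%:P * 'X^(j + l).

Definition gsum l := digit_sum (graded l).

Lemma gsum_split l : parity_split (gsum l) (gsum l.+1) (graded l 0).
Proof.
move=> m; rewrite /gsum; have [-> ->] := digit_sum_split (graded l) m.
suff -> : digit_sum (fun j => graded l j.+1) m = digit_sum (graded l.+1) m by [].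
by apply: eq_bigr => j _; rewrite /graded addnS addSn.
Qed.

Lemma has_top_graded0 l : has_top l (graded l 0).
Proof.
rewrite /graded add0n; split.
  apply: leq_trans (size_polyMleq _ _) _; rewrite size_polyXn addnS /=.
  by rewrite -add1n leq_add2r size_polyC_leq1.
exists false, [:: l]; rewrite big_seq1 mul1r.
by rewrite coefMXn ltnn subnn coefC eqxx.
Qed.

Lemma size_natM (n : nat) P : (size (n%:R * P)%R <= size P)%N.
Proof.
rewrite mulr_natl; apply/leq_sizeP => j le_j.
by rewrite coefMn nth_default ?mul0rn.
Qed.

(** Each parity step raises [l] by one, so that the parameters -2x and 2z which it
    passes on have degree below the new [l] and cannot reach the leading term.
    When [z] is allowed degree [l] only the bound on the degree remains; this is
    what determines the degree of third differences in [size_hankel_d3]. *)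
Lemma hankel_differences_top p l :
  [/\ has_top (deg_d2 p + l * p) (hankel_d2 (gsum l) p),
      forall z : {poly A}, (size z <= l)%N ->
        has_top (deg_d1 p + l * p) (hankel_d1 (gsum l) z p)
    & forall z : {poly A}, (size z <= l.+1)%N ->
        (size (hankel_d1 (gsum l) z p) <= (deg_d1 p + l * p).+1)%N].
Proof.
have size_x k : (size (- 2 * graded k 0)%R <= k.+1)%N.
  rewrite mulNr size_polyN; apply: leq_trans (size_natM 2 _) _.
  by have [] := has_top_graded0 k.
have [m] := ubnP p; elim: m p l => // m IHm p l; rewrite ltnS => le_pm.
have [->|p_gt0] := posnP p.
  rewrite /deg_d2 deg_d10 popcount0 muln0.
  by split=> [|z _|z _]; rewrite /hankel_d2 /hankel_d1 hankel0 //;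
    [exact: has_top1 | exact: has_top1 | exact: size_polyC_leq1].
have {IHm} IH q k (lt_q : (q < p)%N) := IHm q k (leq_trans lt_q le_pm).
have top_d1 k : (forall z : {poly A}, (size z <= k)%N ->
        has_top (deg_d1 p + k * p) (hankel_d1 (gsum k) z p))
  /\ (forall z : {poly A}, (size z <= k.+1)%N ->
        (size (hankel_d1 (gsum k) z p) <= (deg_d1 p + k * p).+1)%N).
  have split_k := gsum_split k.
  have [h [ph|ph]] : exists h, (p = h.*2 \/ p = h.*2.+1)%N.
  - by exists p./2; lia.
  - have lt_hp : (h < p)%N by lia.
    have [_ top_h size_h] := IH h k.+1 lt_hp.
    have degE : (deg_d1 p + k * p = deg_d1 h + k.+1 * h + (deg_d1 h + k.+1 * h))%N.
      by rewrite ph deg_d1_double; lia.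
    rewrite degE ph -addnn; split=> z le_z.
      apply: has_top_sign (hankel_d1_even split_k h z) _.
      apply: has_topM; apply: top_h => //.
      by apply: leq_trans (size_natM 2 z) (leqW le_z).
    rewrite (size_eq_sign (hankel_d1_even split_k h z)).
    apply: size_mul_bound; first by have [] := top_h _ (size_x k).
    by apply: size_h; apply: leq_trans (size_natM 2 z) (leqW le_z).
  have lt_hp : (h < p)%N by lia.
  have [top_h _ _] := IH h k.+1 lt_hp.
  have top_h2 := has_topM top_h top_h; rewrite -expr2 in top_h2.
  have degE : (deg_d1 p + k * p =
      k + (deg_d2 h + k.+1 * h + (deg_d2 h + k.+1 * h)))%N.
    by rewrite ph deg_d1_doubleS; lia.
  rewrite degE ph -addnn; split=> z le_z.
    apply: has_top_sign (hankel_d1_odd split_k h z) _.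
    by apply: has_topM top_h2; apply: has_topD (has_top_graded0 k) _.
  rewrite (size_eq_sign (hankel_d1_odd split_k h z)).
  apply: size_mul_bound (top_h2.1); apply: leq_trans (size_polyD _ _) _.
  by rewrite geq_max le_z andbT; have [] := has_top_graded0 k.
split; [|exact: (top_d1 l).1|exact: (top_d1 l).2].
have [q [r [def_p le_rq]]] : exists q r, p = (q + r)%N /\ (r <= q <= r.+1)%N.
  by exists (uphalf p), p./2; lia.
(* For p = 1 the first factor has the size p itself, at the next shift; it is
   covered by [top_d1] and not by the induction hypothesis. *)
have top_q (z : {poly A}) : (size z <= l.+1)%N ->
    has_top (deg_d1 q + l.+1 * q) (hankel_d1 (gsum l.+1) z q).
  have [<-|lt_qp] : p = q \/ (q < p)%N by lia.
    exact: (top_d1 l.+1).1.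
  by have [_ top_q _] := IH q l.+1 lt_qp; apply: top_q.
have [top_r _ _] := IH r l.+1 ltac:(lia).
rewrite def_p; apply: has_top_sign (hankel_d2_parity (gsum_split l) le_rq) _.
have -> : (deg_d2 (q + r) + l * (q + r) =
    deg_d1 q + l.+1 * q + (deg_d2 r + l.+1 * r))%N.
  by rewrite deg_d2_parity //; lia.
by apply: has_topM (top_q _ _) top_r.
Qed.

(** As [hankel_d3] is the coefficient of z in [hankel_d1], its product with t^l is
    the difference of the values of [hankel_d1] at z = t^l and z = 0; and taking z
    as large as t^l loses nothing in the degree of [hankel_d1]. *)
Lemma size_hankel_d3 p l :
  (size (hankel_d3 (gsum l) p) + l <= (deg_d1 p.+1 + l * p.+1).+1)%N.
Proof.
have [_ _ size_d1] := hankel_differences_top p.+1 l.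
have [->|nz_d3] := eqVneq (hankel_d3 (gsum l) p) 0.
  by rewrite size_poly0; lia.
have /eqP := hankel_d1_affine (gsum l) 'X^l p.
rewrite addrC -subr_eq => /eqP eq_d3.
have := size_d1 'X^l; rewrite size_polyXn leqnn => /(_ isT) size_1.
have := size_d1 0; rewrite size_poly0 => /(_ isT) size_0.
rewrite addnC -size_mulXn // commr_polyXn -eq_d3.
by apply: leq_trans (size_polyD _ _) _; rewrite size_polyN geq_max size_1.
Qed.

(** The correction term has degree at least [k] below that of the product, so it
    is negligible as soon as k > 0.  For n = 2 the product vanishes
    instead, as s'(0) = 0, and the correction term -x^2 is all there is. *)
Lemma hankel_top n l k d : (2 ^ k < n <= 2 ^ k.+1)%N ->
  d.+1 = (deg_d2 n.-1 + k + l * n)%N -> has_top d (hankel (gsum l) n).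
Proof.
elim: k n l d => [|k IHk] n l d n_bounds def_d; last first.
  have [p [q [def_n le_qp]]] : exists p q, n = (p.+1 + q.+1)%N /\ (q <= p <= q.+1)%N.
    by exists (uphalf n).-1, (n./2).-1; have := expn_gt0 2 k; lia.
  have [b eq_h] := hankel_parity2 (gsum_split l) le_qp.
  rewrite def_n; apply: has_top_sign eq_h _.
  have size_x : (size (- 2 * graded l 0)%R <= l.+1)%N.
    rewrite mulNr size_polyN; apply: leq_trans (size_natM 2 _) _.
    by have [] := has_top_graded0 l.
  have degE : deg_d2 n.-1 = (deg_d1 q.+1 + deg_d2 p + (q.+1 + p))%N.
    by rewrite def_n -deg_d2_parity; [congr deg_d2; lia | lia].
  pose d' := (deg_d2 p + k + l.+1 * p.+1).-1.
  have top_h : has_top d' (hankel (gsum l.+1) p.+1).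
    apply: IHk; first by move: n_bounds; rewrite def_n !expnS; lia.
    by rewrite prednK //; lia.
  have [_ /(_ _ size_x) top_d1 _] := hankel_differences_top q.+1 l.+1.
  have -> : d = (d' + (deg_d1 q.+1 + l.+1 * q.+1))%N by rewrite /d'; lia.
  apply: has_topD (has_topM top_h top_d1) _.
  have [size_d2 _] : has_top (deg_d2 p + l.+1 * p) (hankel_d2 (gsum l.+1) p).
    by have [] := hankel_differences_top p l.+1.
  have [size_g _] := has_top_graded0 l.
  have size_g2 := size_mul_bound size_g size_g.
  have size_d3 := size_hankel_d3 q l.+1.
  have {}size_d3 : (size (hankel_d3 (gsum l.+1) q)
      <= (deg_d1 q.+1 + l.+1 * q).+1)%N by lia.
  rewrite size_Msign expr2.
  apply: leq_trans (size_mul_bound size_g2 (size_mul_bound size_d2 size_d3)) _.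
  by rewrite /d'; lia.
have n2 : n = 2%N by lia.
have deg1 : deg_d2 1 = 1%N.
  by rewrite -[1%N]/(0.*2.+1) deg_d2_doubleS deg_d1S /deg_d2 popcount0 deg_d10.
have [b eq_h] := hankel_parity2 (gsum_split l) (isT : (0 <= 0 <= 1)%N).
rewrite n2; apply: has_top_sign eq_h _.
rewrite /hankel_d2 /hankel_d3 !hankel0 !mulr1 [hankel _ 1]detn1.
rewrite [X in X * _ + _]big_ord0 mul0r add0r.
apply: (@has_top_sign _ _ (graded l 0 ^+ 2)); first by exists b.
have -> : d = (l + l)%N by move: def_d; rewrite n2 deg1; lia.
by rewrite expr2; apply: has_topM; apply: has_top_graded0.
Qed.

End LeadingTerm.

(** * Weighted degree and the substitution of powers *)

Lemma polyCXnM (B : comNzRingType) (u v : B) (m n : nat) :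
  (u * v)%:P * 'X^(m + n) = (u%:P * 'X^m) * (v%:P * 'X^n).
Proof. by rewrite exprD polyCM mulrACA. Qed.

Lemma coef_intr_mulXn (B : comNzRingType) (c : int) (u : B) (m n : nat) :
  (c%:~R * (u%:P * 'X^m))`_n = (if n == m then u else 0) *~ c.
Proof.
rewrite mulrzl -[LHS]/(coefp n _) raddfMz /= coefCM coefXn.
by case: eqP; rewrite ?mulr1 ?mulr0.
Qed.

Section Weight.
Implicit Types (a b : {cmonom nat}) (P : wpoly).

Definition weight a : nat := (\sum_(j <- finsupp a) j * a j)%N.

Lemma weight_widen a (E : {fset nat}) : (finsupp a `<=` E)%fset ->
  weight a = (\sum_(j <- E) j * a j)%N.
Proof.
move=> le_aE; rewrite /weight (big_fset_incl _ le_aE) // => j _.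
by rewrite -cmE_neq0 negbK => /eqP ->; rewrite muln0.
Qed.

Lemma weightM a b : weight (mmul a b) = (weight a + weight b)%N.
Proof.
rewrite {1}/weight mdomD.
rewrite (weight_widen (fsubsetUl (finsupp a) (finsupp b))).
rewrite (weight_widen (fsubsetUr (finsupp a) (finsupp b))).
by rewrite -big_split /=; apply: eq_bigr => j _; rewrite cmM mulnDr.
Qed.

Lemma weight1 : weight mone = 0%N.
Proof. by rewrite /weight mdom1 big_seq_fset0. Qed.

Lemma weightU j : weight (ucm j) = j.
Proof. by rewrite /weight mdomU big_seq_fset1 cmUU muln1. Qed.

Definition X_weight a : {poly int} := 'X^(weight a).

Fact X_weight_morph : mmorphism X_weight.
Proof.
by split=> [a b|]; rewrite /X_weight ?weightM ?exprD // weight1 expr0.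
Qed.
HB.instance Definition _ := monalg.isMultiplicative.Build _ _ X_weight X_weight_morph.

Lemma mkmalgUM a b :
  mkmalgU (mmul a b) 1 = mkmalgU a 1 * mkmalgU b 1 :> wpoly.
Proof. by rewrite malgM_def fgmulUU mulr1. Qed.

(** Unlike [X_weight], this keeps the monomial next to the power of t, so no
    cancellation between monomials of equal weight can occur. *)
Definition graded_monom a : {poly wpoly} := (mkmalgU a 1)%:P * 'X^(weight a).

Fact graded_monom_morph : mmorphism graded_monom.
Proof.
split=> [a b|]; last by rewrite /graded_monom weight1 expr0 mulr1.
by rewrite /graded_monom weightM mkmalgUM polyCXnM.
Qed.
HB.instance Definition _ :=
  monalg.isMultiplicative.Build _ _ graded_monom graded_monom_morph.

Lemma mmap_Hw (S : comNzRingType) (f : {rmorphism int -> S})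
    (h : {mmorphism {cmonom nat} -> S}) n :
  mmap f h (Hw n) = hankel (digit_sum (fun j => h (ucm j))) n.
Proof.
rewrite /Hw /hankel_det -det_map_mx; congr (\det _).
apply/matrixP => i j; rewrite !mxE raddf_sum; apply: eq_bigr => l _.
rewrite raddfMn; congr (_ *+ _); rewrite /= mmapU -[RHS]mul1r.
by congr (_ * _); apply: (rmorph1 f).
Qed.

Lemma subst_powersE P :
  subst_powers P = mmap (@polyC int) X_weight P.
Proof.
apply: eq_bigr => a _; congr (_ * _); rewrite /X_weight /weight.
rewrite (big_morph (fun m => 'X^m) (@exprD _ 'X) (expr0 'X)).
by apply: eq_bigr => j _; rewrite exprM.
Qed.

Lemma coef_subst_powers P d :
  (subst_powers P)`_d = \sum_(a <- msupp P | weight a == d) P@_a.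
Proof.
rewrite subst_powersE coef_sum [RHS]big_mkcond; apply: eq_bigr => a _.
by rewrite coefCM coefXn eq_sym; case: eqP; rewrite ?mulr1 ?mulr0.
Qed.

Lemma size_subst_powers P : (size (subst_powers P) <= (wdeg P).+1)%N.
Proof.
apply/leq_sizeP => d lt_d; rewrite coef_subst_powers big_seq_cond big1 // => a.
case/andP=> a_in /eqP weight_a; move: lt_d; rewrite -weight_a ltnNge => /negP[].
by rewrite /wdeg; apply: leq_bigmax_seq.
Qed.

(** The coefficient at t^m of the image of [P] is its component of weight [m]. *)
Lemma wdeg_le P d :
  (size (mmap (intr : int -> {poly wpoly}) graded_monom P) <= d.+1)%N ->
  (wdeg P <= d)%N.
Proof.
move=> le_d; apply/bigmax_leqP_seq => a a_in _; rewrite -/(weight a) leqNgt.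
apply/negP => lt_d; have := a_in; rewrite -mcoeff_neq0 => /negP; apply.
have /(congr1 (mcoeff a)) := leq_sizeP _ _ le_d _ lt_d.
rewrite coef_sum raddf_sum mcoeff0 => <-; apply/eqP.
rewrite (bigD1_seq a) ?fset_uniq //= big1 ?addr0 => [|i ne_ia].
  by rewrite coef_intr_mulXn eqxx raddfMz /= mcoeffU eqxx mulr1n intz.
rewrite coef_intr_mulXn raddfMz /=.
by case: eqP; rewrite ?mcoeff0 ?mul0rz // mcoeffU (negPf ne_ia) mul0rz.
Qed.

Lemma graded_wvar j : graded_monom (ucm j) = graded wvar 0 j.
Proof. by rewrite /graded_monom /graded weightU addn0. Qed.

Lemma X_weight_ucm j : X_weight (ucm j) = graded (fun=> 1) 0 j.
Proof. by rewrite /X_weight /graded weightU addn0 mul1r. Qed.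

End Weight.

(** * Degree and leading coefficient of the specialised determinant *)

(** The generic weights give D n <= d, the weights 1 give the degree and the
    leading coefficient of Ht n, and the degree of Ht n is at most D n. *)
Lemma hankel_degrees n k d : (2 ^ k < n <= 2 ^ k.+1)%N ->
    d.+1 = (deg_d2 n.-1 + k)%N ->
  [/\ D n = d, size (Ht n) = d.+1 & lead_coef (Ht n) = 1 \/ lead_coef (Ht n) = -1].
Proof.
move=> n_bounds def_d.
have le_Dd : (D n <= d)%N.
  apply: wdeg_le; rewrite (mmap_Hw intr graded_monom).
  have <- : hankel (gsum wvar 0) n = hankel (digit_sum (fun j => graded_monom (ucm j))) n.
    by apply: eq_hankel => m; apply: eq_bigr => j _; rewrite graded_wvar.
  by have [] := @hankel_top _ wvar n 0 k d n_bounds; rewrite ?addn0.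
have HtE : Ht n = hankel (gsum (fun=> 1) 0) n.
  rewrite /Ht subst_powersE (mmap_Hw (@polyC int) X_weight).
  by apply: eq_hankel => m; apply: eq_bigr => j _; rewrite -X_weight_ucm.
have [|le_d [b [r top_d]]] := @hankel_top int (fun=> 1) n 0 k d n_bounds.
  by rewrite addn0.
rewrite -HtE big1 // mulr1 in le_d top_d.
have size_d : size (Ht n) = d.+1.
  apply/eqP; rewrite eqn_leq le_d ltnNge; apply/negP => /leq_sizeP/(_ d (leqnn d)).
  by rewrite top_d => /eqP; rewrite signr_eq0.
split=> //; last first.
  by rewrite /lead_coef size_d /= top_d; case: b {top_d}; [right|left].
by apply/eqP; rewrite eqn_leq le_Dd -ltnS -size_d size_subst_powers.
Qed.

Lemma leq_deg_d2 p : (p <= deg_d2 p)%N.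
Proof.
have le_p : (p./2 <= uphalf p <= p./2.+1)%N by lia.
have def_p : (uphalf p + p./2 = p)%N by lia.
by have := deg_d2_parity le_p; rewrite def_p; lia.
Qed.

Lemma D_popcount n k : (2 ^ k < n <= 2 ^ k.+1)%N -> (D n).+1 = (deg_d2 n.-1 + k)%N.
Proof.
move=> n_bounds; have := leq_deg_d2 n.-1; have := expn_gt0 2 k => pow_gt0 le_n.
have def_d : (deg_d2 n.-1 + k).-1.+1 = (deg_d2 n.-1 + k)%N by lia.
by have [-> _ _] := hankel_degrees n_bounds def_d.
Qed.

Theorem proposition4p8 (n : nat) (n_ge2 : (2 <= n)%N) :
  [/\ forall k : nat, (3 <= n)%N -> (2 ^ k < n <= 2 ^ k.+1)%N ->
        (D n)%:Z =
          if (n <= 3 * 2 ^ k.-1)%N then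
            (D (2 ^ k.+1 - n + 1)%N)%:Z
              + (2 * n%:Z - 2 ^+ k.+1 - 1) * (k%:Z + 1) + 1
          else
            (D (n - 2 ^ k)%N)%:Z + 2 * n%:Z + 2 ^+ k * (k%:Z - 2),
      lead_coef (Ht n) = 1 \/ lead_coef (Ht n) = -1
    & size (Ht n) = (D n).+1].
Proof.
have [k0 n_bounds0] : exists k, (2 ^ k < n <= 2 ^ k.+1)%N.
  exists (trunc_log 2 n.-1).
  by have := @trunc_log_bounds 2 n.-1 isT; lia.
have [_ size_n lead_n] := hankel_degrees n_bounds0 (D_popcount n_bounds0).
split=> // k n_ge3 n_bounds; have Dn := D_popcount n_bounds.
case: k n_bounds Dn => [|k] n_bounds; first lia.
(* Here b = 2^(k+2) - n is the index paired with n - 1 by the reflection, and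
   r + 1 = n - 2^(k+1); in the second case r is paired with the same b. *)
have [b [r [def_M def_n]]] : exists b r, (2 ^ k.+1 = b + r.+1 /\ n = b + r.*2.+2)%N.
  exists (2 ^ k.+2 - n)%N, (n - 2 ^ k.+1).-1; move: n_bounds; rewrite !expnS; lia.
have M2 : (2 ^ k.+2 = b + r.+1 + (b + r.+1))%N by rewrite expnS def_M; lia.
have := (deg_reflection k.+2 (b + r.*2.+1) b).2.
rewrite M2 -[2 ^+ k.+2]natrX -[2 ^+ k.+1]natrX M2 def_M.
have half_M : (2 ^ k + 2 ^ k = b + r.+1)%N by rewrite -def_M expnS; lia.
move=> /(_ ltac:(lia)) refl_n Dn.
have n1 : n.-1 = (b + r.*2.+1)%N by lia.
rewrite {}n1 in Dn.
rewrite /=; case: ifP => le_n.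
  have -> : (b + r.+1 + (b + r.+1) - n + 1 = b.+1)%N by lia.
  have Db := @D_popcount b.+1 k; rewrite expnS in Db.
  have {}Db := Db ltac:(lia); rewrite /= in Db.
  lia.
have -> : (n - (b + r.+1) = r.+1)%N by lia.
have Dr := @D_popcount r.+1 k; rewrite expnS in Dr.
have {}Dr := Dr ltac:(lia); rewrite /= in Dr.
have := (deg_reflection k.+1 r b).2; rewrite def_M => /(_ ltac:(lia)) refl_r.
lia.
Qed.
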